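(* FIFO is an $O(m)$-approximation for F-WGP: there is an absolute constant $c>0$ such that for every instance with $m$ packets, the maximum flow time $\max_j F_j$ of the FIFO schedule is at most $c\cdot m$ times the optimal maximum flow time over all feasible schedules.
   Context: The Wireless Gathering Problem (WGP). An instance consists of a finite connected undirected graph $G=(V,E)$, a sink node $s\in V$, a positive integer $d_I$ (interference radius), and a set of packets $J=\{1,\dots,m\}$; each packet $j$ has an origin $o_j\in V$ and a release date $r_j\in\mathbb{Z}_{\ge 0}$. Time is divided into rounds $0,1,2,\dots$. In a round, if $u,v$ are adjacent, $u$ may send a packet it currently holds to $v$; this is a call $(u,v)$. Let $d(u,v)$ be the shortest-path distance in $G$. Two calls $(u,v)$ and $(u',v')$ in the same round interfere if $d(u',v)\le d_I$ or $d(u,v')\le d_I$; otherwise they are compatible. A feasible schedule specifies, for each round, a set of pairwise compatible calls, each moving one packet, such that every packet exists in a unique copy, packet $j$ is not sent before round $r_j$, and every packet eventually reaches $s$. If $x_j^t$ is the node holding $j$ at time $t$ (a packet sent in round $t$ is at its new node at time $t+1$), the completion time is $C_j=\min\{t: x_j^t=s\}$ and the flow time is $F_j=C_j-r_j$. F-WGP is the problem of finding a feasible schedule minimizing $\max_j F_j$. Priority Greedy: each packet is given a unique priority; in every round, the available packets (released and not yet at $s$) are considered in order of decreasing priority, and each is sent from its current node to a neighbor one step closer to $s$, provided this call causes no interference with the calls already chosen in this round for higher-priority packets. FIFO is the Priority Greedy algorithm in which packets with earlier release dates have higher priority (ties broken arbitrarily). *)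

(* Defs.v *)
From mathcomp Require Import all_boot.
Set Implicit Arguments.
Unset Strict Implicit.
Unset Printing Implicit Defensive.

Record wgp_instance (V : finType) (m : nat) := WgpInstance {
  edge : rel V;
  edge_sym : symmetric edge;
  edge_irr : irreflexive edge;
  edge_connected : forall u v, connect edge u v;
  sink : V;
  radius : nat;
  radius_gt0 : 0 < radius;
  origin : 'I_m -> V;
  release : 'I_m -> nat
}.

Section WirelessGathering.
Variables (V : finType) (m : nat) (I : wgp_instance V m).

Definition walk (u v : V) (n : nat) : bool :=
  [exists p : n.-tuple V, path (edge I) u p && (last u p == v)].

Lemma walk_exists u v : exists n, walk u v n.
Proof.
have /connectP[p pth lst] := edge_connected I u v.
exists (size p); apply/existsP; exists (in_tuple p).
by rewrite pth lst eqxx.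
Qed.

Definition dist (u v : V) : nat := ex_minn (walk_exists u v).

(* A call is the pair (sender, receiver). *)
Definition interfere (a b : V * V) : bool :=
  (dist b.1 a.2 <= radius I) || (dist a.1 b.2 <= radius I).

(* [S t j] is the node to which packet [j] is sent in round [t], or [None]
   if [j] does not move.  The sender is the node holding [j], so that each
   packet automatically exists in a unique copy. *)
Definition schedule := nat -> 'I_m -> option V.

Definition move (x : 'I_m -> V) (round : 'I_m -> option V) : 'I_m -> V :=
  fun j => odflt (x j) (round j).

(* Before its release a packet is recorded at its origin. *)
Fixpoint position (S : schedule) (t : nat) : 'I_m -> V :=
  if t is t'.+1 then move (position S t') (S t') else origin I.

(* The position of a packet counts only from its release on: a packet
   originating at the sink is thus completed at its release date, with flow
   time 0.  For every other packet of a feasible schedule the condition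
   [release I j <= t] is implied by the second one. *)
Definition at_sink (S : schedule) (j : 'I_m) (t : nat) : bool :=
  (release I j <= t) && (position S t j == sink I).

(* In [feasible_compatible] equal calls of distinct packets are excluded too,
   as a call interferes with itself when its ends are adjacent. *)
Record feasible (S : schedule) : Prop := Feasible {
  feasible_adjacent : forall t j v,
    S t j = Some v -> edge I (position S t j) v;
  feasible_released : forall t j v, S t j = Some v -> release I j <= t;
  feasible_compatible : forall t j k v w, j != k ->
    S t j = Some v -> S t k = Some w ->
    ~~ interfere (position S t j, v) (position S t k, w);
  feasible_complete : forall j, exists t, at_sink S j t
}.

Definition completion_time (S : schedule) (FS : feasible S) (j : 'I_m) : nat :=
  ex_minn (feasible_complete FS j).

Definition flow_time (S : schedule) (FS : feasible S) (j : 'I_m) : nat :=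
  completion_time FS j - release I j.

Definition max_flow_time (S : schedule) (FS : feasible S) : nat :=
  \max_(j < m) flow_time FS j.

Definition optimal_max_flow_time (opt : nat) : Prop :=
  (exists (S : schedule) (FS : feasible S), max_flow_time FS = opt) /\
  (forall (S : schedule) (FS : feasible S), opt <= max_flow_time FS).

(* The choice among the neighbours one step closer to the sink is free, and
   may depend on the round and on the packet. *)
Definition next_hop_rule (next : nat -> 'I_m -> V -> V) : Prop :=
  forall t j u, u != sink I ->
    edge I u (next t j u) /\ dist u (sink I) = (dist (next t j u) (sink I)).+1.

(* A larger value of [prio] means a higher priority. *)
Definition fifo_priority (prio : 'I_m -> nat) : Prop :=
  injective prio /\
  (forall j k, release I j < release I k -> prio k < prio j).

Section PriorityGreedy.
Variables (prio : 'I_m -> nat) (next : nat -> 'I_m -> V -> V).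

Definition available (t : nat) (x : 'I_m -> V) (j : 'I_m) : bool :=
  (release I j <= t) && (x j != sink I).

Definition pg_queue (t : nat) (x : 'I_m -> V) : seq 'I_m :=
  sort (fun j k => prio k <= prio j) (filter (available t x) (enum 'I_m)).

Definition pg_call (t : nat) (x : 'I_m -> V) (j : 'I_m) : V * V :=
  (x j, next t j (x j)).

Definition pg_step (t : nat) (x : 'I_m -> V) (chosen : seq 'I_m) (j : 'I_m) :
    seq 'I_m :=
  if has (fun k => interfere (pg_call t x j) (pg_call t x k)) chosen
  then chosen else rcons chosen j.

Definition pg_round (t : nat) (x : 'I_m -> V) (j : 'I_m) : option V :=
  if j \in foldl (pg_step t x) [::] (pg_queue t x)
  then Some (next t j (x j)) else None.

Fixpoint pg_position (t : nat) : 'I_m -> V :=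
  if t is t'.+1 then move (pg_position t') (pg_round t' (pg_position t'))
  else origin I.

Definition priority_greedy : schedule := fun t => pg_round t (pg_position t).

End PriorityGreedy.

End WirelessGathering.

(* Main.v *)
(* The first packet of the queue is never blocked, so in every round in which
   some packet is available at least one packet gets one step closer to the
   sink.  Hence the sum over all packets of the distance to the sink strictly
   decreases as long as a given packet [j] is available, and the flow time of
   [j] is at most the initial sum of distances.  Each of these [m] distances is
   a lower bound on the optimum, so the ratio is at most [m]. *)
Require Import Defs.
From mathcomp Require Import all_boot.
From Stdlib Require Import Classical.
Set Implicit Arguments.
Unset Strict Implicit.
Unset Printing Implicit Defensive.

(** Serves to pick an optimal schedule: being the value of some feasible schedule is not a boolean
    predicate, so [ex_minn] does not apply and the least element is obtained classically. *)
Lemma ex_min_Prop (P : nat -> Prop) :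
  (exists n, P n) -> exists n, P n /\ forall k, P k -> n <= k.
Proof.
move=> [n0 Pn0]; apply: NNPP => noMin.
suff noP n : forall k, k <= n -> ~ P k by exact: (noP n0 n0).
elim: n => [|n IHn] k le_kn Pk; apply: noMin; exists k; split=> // i Pi.
  by move: le_kn; rewrite leqn0 => /eqP->.
rewrite leqNgt; apply/negP => lt_ik.
by apply: (IHn i) => //; rewrite -ltnS (leq_trans lt_ik).
Qed.

Section Gathering.
Variables (V : finType) (m : nat) (I : wgp_instance V m).
Implicit Types (u v w : V) (j k : 'I_m) (t n : nat) (x : 'I_m -> V).

Lemma dist_walk u v : walk I u v (dist I u v).
Proof. by rewrite /dist; case: ex_minnP. Qed.

Lemma dist_le u v n : walk I u v n -> dist I u v <= n.
Proof. by rewrite /dist; case: ex_minnP => i _ + wn; apply. Qed.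

Lemma dist_eq0 u v : (dist I u v == 0) = (u == v).
Proof.
apply/eqP/eqP => [d0 | ->].
  have := dist_walk u v; rewrite d0 => /existsP[p].
  by rewrite (tuple0 p) => /eqP.
by apply/eqP; rewrite -leqn0 dist_le //; apply/existsP; exists [tuple] => /=.
Qed.

Lemma dist_edge u w v : edge I u w -> dist I u v <= (dist I w v).+1.
Proof.
move=> uw; apply: dist_le; have /existsP[p wp] := dist_walk w v.
by apply/existsP; exists [tuple of w :: p]; rewrite /= uw.
Qed.

Lemma interfereC : symmetric (interfere I).
Proof. by move=> a b; rewrite /interfere orbC. Qed.

Section AnySchedule.
Variables (S : schedule V m) (FS : feasible I S).

(** Each call brings a packet at most one step closer to the sink, and calls happen only from the
    release on. Before the release the truncated difference is 0 and the packet rests at its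
    origin. *)
Lemma dist_origin_le_position j t :
  dist I (origin I j) (sink I)
    <= dist I (position I S t j) (sink I) + (t - release I j).
Proof.
elim: t => [|t IHt] /=; first by rewrite leq_addr.
rewrite /move; case Sj: (S t j) => [v|] /=.
  have rj := feasible_released FS Sj.
  (* Since [j] is already released, this round adds exactly one to the elapsed time, which pays for
     the edge crossed. *)
  apply: leq_trans IHt _; rewrite subSn // addnS -addSn leq_add2r.
  exact/dist_edge/(feasible_adjacent FS Sj).
by apply: leq_trans IHt _; rewrite leq_add2l leq_sub2r.
Qed.

Lemma dist_origin_le_flow_time j :
  dist I (origin I j) (sink I) <= flow_time FS j.
Proof.
rewrite /flow_time /completion_time; case: ex_minnP => t /andP[_ /eqP xt] _.
have := dist_origin_le_position j t; rewrite xt.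
by have /eqP -> : dist I (sink I) (sink I) == 0 by rewrite dist_eq0.
Qed.

Lemma sum_dist_origin_le :
  \sum_(j < m) dist I (origin I j) (sink I) <= m * max_flow_time FS.
Proof.
rewrite -[X in _ <= X * _]card_ord -sum_nat_const; apply: leq_sum => j _.
exact/(leq_trans (dist_origin_le_flow_time j))/leq_bigmax.
Qed.

End AnySchedule.

Section Greedy.
Variables (prio : 'I_m -> nat) (next : nat -> 'I_m -> V -> V).
Hypothesis next_hop : next_hop_rule I next.

Local Notation S := (priority_greedy I prio next).
Local Notation step := (pg_step I next).

Lemma position_pg t : position I S t = pg_position I prio next t.
Proof. by elim: t => //= t ->. Qed.

(** A call once chosen is never withdrawn in favour of a later one. *)
Lemma pg_step_sub t x q (c : seq 'I_m) : {subset c <= foldl (step t x) c q}.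
Proof.
elim: q c => [|k q IHq] c j jc //=; apply: IHq; rewrite /pg_step.
by case: ifP => // _; rewrite mem_rcons in_cons jc orbT.
Qed.

Lemma mem_pg_steps t x q (c : seq 'I_m) j :
  j \in foldl (step t x) c q -> (j \in c) || (j \in q).
Proof.
elim: q c => /= [c -> //|k q IHq c /IHq].
rewrite /pg_step in_cons; case: ifP => _; rewrite ?mem_rcons ?in_cons.
  by case/orP=> ->; rewrite ?orbT.
by rewrite orbCA orbA.
Qed.

Definition compatible_packets t x (c : seq 'I_m) :=
  forall j k, j \in c -> k \in c -> j != k ->
    ~~ interfere I (pg_call next t x j) (pg_call next t x k).

Lemma pg_steps_compatible t x q c :
  compatible_packets t x c -> compatible_packets t x (foldl (step t x) c q).
Proof.
elim: q c => //= i q IHq c cc; apply: IHq.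
rewrite /pg_step; case: ifPn => // /hasPn ci j k.
rewrite !mem_rcons !in_cons.
case/predU1P=> [->|jc]; case/predU1P=> [->|kc] jk.
- by rewrite eqxx in jk.
- exact: ci k kc.
(* The greedy test puts the new call first; symmetry covers the other order. *)
- by rewrite interfereC; exact: ci j jc.
- exact: cc.
Qed.

Lemma mem_pg_queue t x j : (j \in pg_queue I prio t x) = available I t x j.
Proof. by rewrite mem_sort mem_filter mem_enum andbT. Qed.

Lemma pg_roundP t x j v : pg_round I prio next t x j = Some v ->
  [/\ v = next t j (x j), available I t x j
    & j \in foldl (step t x) [::] (pg_queue I prio t x)].
Proof.
rewrite /pg_round; case: ifP => // jc [<-]; split=> //.
by have := mem_pg_steps jc; rewrite mem_pg_queue.
Qed.

(** The head of the queue is tested against an empty list of chosen calls, so it is accepted; the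
    packet that moves may differ from [j]. *)
Lemma pg_round_progress t x j :
  available I t x j -> exists k v, pg_round I prio next t x k = Some v.
Proof.
rewrite -(mem_pg_queue t x j) /pg_round.
case: (pg_queue _ _ _ _) => [//|k q] _.
by exists k, (next t k (x k)); rewrite /= pg_step_sub // mem_head.
Qed.

(** The potential function of the greedy analysis. *)
Definition total_dist x := \sum_(j < m) dist I (x j) (sink I).

Lemma dist_move_lt t x j v : pg_round I prio next t x j = Some v ->
  dist I (move x (pg_round I prio next t x) j) (sink I) < dist I (x j) (sink I).
Proof.
move=> Rj; rewrite /move Rj /=; have [-> /andP[_ xj] _] := pg_roundP Rj.
by have [_ ->] := next_hop t j xj.
Qed.

Lemma dist_move_le t x j :
  dist I (move x (pg_round I prio next t x) j) (sink I) <= dist I (x j) (sink I).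
Proof.
case Rj: (pg_round I prio next t x j) => [v|]; first exact/ltnW/(dist_move_lt Rj).
by rewrite /move Rj.
Qed.

Lemma total_dist_move t x :
  total_dist (move x (pg_round I prio next t x)) <= total_dist x.
Proof. by apply: leq_sum => j _; exact: dist_move_le. Qed.

Lemma total_dist_move_lt t x j : available I t x j ->
  total_dist (move x (pg_round I prio next t x)) < total_dist x.
Proof.
case/pg_round_progress=> k [v Rk].
rewrite /total_dist (bigD1 k) //= [X in _ < X](bigD1 k) //= -addSn.
by apply: leq_add; [exact: dist_move_lt Rk | apply: leq_sum => i _; exact: dist_move_le].
Qed.

Lemma total_dist_pg t :
  total_dist (pg_position I prio next t) <= total_dist (origin I).
Proof. by elim: t => //= t; exact/leq_trans/total_dist_move. Qed.

Lemma pg_at_sink j : exists2 t,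
  t <= release I j + total_dist (origin I) & at_sink I S j t.
Proof.
pose y n := pg_position I prio next (release I j + n).
(* Either [j] arrives within the first [n] rounds after its release, or each of these rounds lowered
   the potential by at least one. *)
have H n : (exists2 i, i < n & at_sink I S j (release I j + i)) \/
           total_dist (y n) + n <= total_dist (origin I).
  elim: n => [|n [[i lin ai]|IHn]]; first by right; rewrite addn0 total_dist_pg.
    by left; exists i => //; exact: ltnW.
  case ai: (at_sink I S j (release I j + n)); first by left; exists n.
  right; apply: leq_trans IHn; rewrite addnS -addSn leq_add2r /y addnS /=.
  apply: (@total_dist_move_lt _ _ j); rewrite /available leq_addr /=.
  by move: ai; rewrite /at_sink leq_addr position_pg => /negbT.
have [[i lti ai]|] := H (total_dist (origin I)).
  by exists (release I j + i) => //; rewrite leq_add2l ltnW.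
(* The whole initial potential is used up, so every packet, [j] included, is at distance 0 from the
   sink. *)
rewrite -[X in _ <= X]add0n leq_add2r leqn0 sum_nat_eq0 => /forallP/(_ j).
rewrite dist_eq0 => yj; exists (release I j + total_dist (origin I)) => //.
by rewrite /at_sink leq_addr position_pg.
Qed.

Lemma priority_greedy_feasible : feasible I S.
Proof.
split.
- move=> t j v; rewrite position_pg => /pg_roundP[-> /andP[_ xj] _].
  by have [] := next_hop t j xj.
- by move=> t j v /pg_roundP[_ /andP[]].
- move=> t j k v w jk; rewrite position_pg => /pg_roundP[-> _ jc].
  case/pg_roundP=> -> _ kc.
  (* The selection starts from the empty list, which is vacuously compatible. *)
  exact: (@pg_steps_compatible _ _ _ [::] _ j k jc kc jk).
- by move=> j; have [t _ at_t] := pg_at_sink j; exists t.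
Qed.

Lemma max_flow_time_pg (FS : feasible I S) :
  max_flow_time FS <= total_dist (origin I).
Proof.
apply/bigmax_leqP => j _; rewrite /flow_time /completion_time.
case: ex_minnP => c _ c_min; have [t le_t /c_min le_ct] := pg_at_sink j.
by rewrite leq_subLR (leq_trans le_ct).
Qed.

End Greedy.

End Gathering.

Theorem theorem4p8 :
  exists c : nat, 0 < c /\
  forall (V : finType) (m : nat) (I : wgp_instance V m)
         (prio : 'I_m -> nat) (next : nat -> 'I_m -> V -> V),
    fifo_priority I prio ->
    next_hop_rule I next ->
    exists FIFO : feasible I (priority_greedy I prio next),
      exists opt : nat,
        optimal_max_flow_time I opt /\
        max_flow_time FIFO <= c * m * opt.
Proof.
exists 1; split=> // V m I prio next _ next_hop.
pose FIFO := priority_greedy_feasible prio next_hop; exists FIFO.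
(* The set of attained values is nonempty because the greedy schedule itself is feasible. *)
have [|opt [[S [FS Sopt]] opt_min]] := @ex_min_Prop (fun n =>
  exists (S : schedule V m) (FS : feasible I S), max_flow_time FS = n).
  by exists (max_flow_time FIFO), (priority_greedy I prio next), FIFO.
exists opt; split.
  by split=> [|S' FS']; [exists S, FS | apply: opt_min; exists S', FS'].
(* The initial potential links both sides: it bounds the greedy flow time from above and is at most
   [m] times the value of the optimal schedule [S]. *)
rewrite mul1n -Sopt; apply: leq_trans (sum_dist_origin_le FS).
exact: max_flow_time_pg.
Qed.
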